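(* Let $K\subset\mathbb R^d$ be an arbitrary compact container, let $w>0$, and let $r_1>r_2>\dots>r_n>0$ be superincreasing radii, i.e. $r_i>\sum_{j>i}r_j$ for all $i$. Then the selection greedy computes the lex-max feasible set, and this set maximizes $\sum_{i\in S}v(r_i)$ over all feasible sets $S$, for every function $v:(0,\infty)\to\mathbb R$ that is positive, strictly increasing and superadditive ($v(x)+v(y)\le v(x+y)$ for all $x,y>0$). In particular it maximizes the contact area $A(S)=\sum_{i\in S}a(r_i)$, where $a(r)=\pi\bigl(r^2-\max(0,r-w)^2\bigr)$.
   Context: Model. Fix a width $w>0$ and a compact container $K\subset\mathbb R^d$, $d\ge1$ (the pan). An inventory is a finite list of radii $r_1>r_2>\dots>r_n>0$; ring $i$ has outer radius $r_i$ and hole radius $\max(0,r_i-w)$. A placement of a set $S\subseteq\{1,\dots,n\}$ of rings is a forest: each ring of $S$ has as parent either the pan or another ring of $S$ with $r_{\mathrm{child}}\le r_{\mathrm{parent}}-w$, and the children of each common parent must be packable in the parent's region ($K$ for the pan; a ball of radius $r-w$ for the hole of a ring of radius $r$), i.e. closed balls having the children's outer radii can be positioned inside that region with pairwise disjoint interiors. Feasibility depends only on the parent assignment. A set $S$ is feasible if it has a placement. Lex-max set: the unique feasible set $L$ such that for every feasible $S\ne L$ the smallest index at which $S$ and $L$ differ belongs to $L$. Equivalently, it is obtained by scanning $i=1,\dots,n$ and including $i$ whenever $(L\cap\{1,\dots,i-1\})\cup\{i\}$ is feasible. Selection greedy: start with the empty set, scan the rings in order of decreasing radius, and add ring $i$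 to the current set exactly when the resulting set is feasible. *)

(* Defs.v *)
From HB Require Import structures.
From mathcomp Require Import all_boot all_order all_algebra.
From mathcomp Require Import all_classical all_reals all_analysis.

Set Implicit Arguments.
Unset Strict Implicit.
Unset Printing Implicit Defensive.

Import Order.TTheory GRing.Theory Num.Theory.
Import numFieldNormedType.Exports.

Local Open Scope classical_set_scope.
Local Open Scope ring_scope.

(* The norm of 'rV[R]_d supplied by MathComp-Analysis is the sup norm, so the
   Euclidean one is spelled out; both induce the same topology, hence [compact]
   and [interior] below are the usual notions on R^d. *)
Definition enorm {R : realType} {d : nat} (x : 'rV[R]_d) : R :=
  Num.sqrt (\sum_(k < d) x 0 k ^+ 2).

Definition eball {R : realType} {d : nat} (c : 'rV[R]_d) (rho : R) :
    set 'rV[R]_d :=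
  [set x | enorm (x - c) <= rho].

Definition hole_radius {R : realType} (w rho : R) : R := Num.max 0 (rho - w).

(* Only the values of the centre function [c] on [C] matter. *)
Definition packable {R : realType} {d n : nat} (r : 'I_n -> R)
    (Q : set 'rV[R]_d) (C : {set 'I_n}) : Prop :=
  exists c : 'I_n -> 'rV[R]_d,
    (forall i, i \in C -> eball (c i) (r i) `<=` Q) /\
    (forall i j, i \in C -> j \in C -> i != j ->
       interior (eball (c i) (r i)) `&` interior (eball (c j) (r j)) = set0).

(* [p i = None] means that the parent of ring [i] is the pan [K], and
   [p i = Some j] that it is ring [j]; only the values of [p] on [S] matter.
   For [0 < w] a parent is strictly larger than its children, so the parent
   relation is acyclic, i.e. a forest. The hole of a ring is taken centred at
   the origin, packability being translation invariant. *)
Definition placement {R : realType} {d n : nat} (K : set 'rV[R]_d) (w : R)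
    (r : 'I_n -> R) (S : {set 'I_n}) (p : 'I_n -> option 'I_n) : Prop :=
  [/\ forall i j, i \in S -> p i = Some j ->
        [/\ j \in S, j != i & r i <= r j - w],
      packable r K [set i in S | p i == None]%SET
    & forall j, j \in S ->
        packable r (eball (0 : 'rV[R]_d) (hole_radius w (r j)))
                 [set i in S | p i == Some j]%SET].

Definition feasible {R : realType} {d n : nat} (K : set 'rV[R]_d) (w : R)
    (r : 'I_n -> R) (S : {set 'I_n}) : Prop :=
  exists p : 'I_n -> option 'I_n, placement K w r S p.

Definition lex_max {R : realType} {d n : nat} (K : set 'rV[R]_d) (w : R)
    (r : 'I_n -> R) (L : {set 'I_n}) : Prop :=
  feasible K w r L /\
  forall S : {set 'I_n}, feasible K w r S -> S <> L ->
    exists i : 'I_n,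
      [/\ i \in L, i \notin S
        & forall j : 'I_n, (j < i)%N -> (j \in S) = (j \in L)].

(* [enum 'I_n] lists the indices increasingly, that is, in order of decreasing
   radius when [r] is strictly decreasing. *)
Definition selection_greedy {R : realType} {d n : nat} (K : set 'rV[R]_d)
    (w : R) (r : 'I_n -> R) : {set 'I_n} :=
  foldl (fun (A : {set 'I_n}) (i : 'I_n) =>
           if `[< feasible K w r (i |: A)%SET >] then (i |: A)%SET else A)
        finset.set0 (enum 'I_n).

Definition total {R : realType} {n : nat} (v : R -> R) (r : 'I_n -> R)
    (S : {set 'I_n}) : R :=
  \sum_(i in S) v (r i).

Definition maximizes_total {R : realType} {d n : nat} (K : set 'rV[R]_d)
    (w : R) (r : 'I_n -> R) (v : R -> R) (L : {set 'I_n}) : Prop :=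
  feasible K w r L /\
  forall S : {set 'I_n}, feasible K w r S -> total v r S <= total v r L.

Definition contact_area {R : realType} (w rho : R) : R :=
  pi * (rho ^+ 2 - hole_radius w rho ^+ 2).

(* Main.v *)
Require Import Defs.
From HB Require Import structures.
From mathcomp Require Import all_boot all_order all_algebra.
From mathcomp Require Import all_classical all_reals all_analysis.
From mathcomp Require Import lra.

Set Implicit Arguments.
Unset Strict Implicit.
Unset Printing Implicit Defensive.

Import Order.TTheory GRing.Theory Num.Theory.
Import numFieldNormedType.Exports.

Local Open Scope classical_set_scope.
Local Open Scope ring_scope.

(** Two ideas carry the result.

    Only the ordering of the radii matters for the greedy.  A ring is strictly
    smaller than its parent, so discarding all rings beyond some index never
    orphans a ring that is kept, and feasibility passes from a set to its
    initial segments ([feasible_initial]).  For a family of sets with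
    this closure property, the scan skips a ring only when no member that made
    the same choices so far contains it ([greedy_initial]); hence its result
    is lexicographically maximal, and it is the only such set because two distinct
    lex-max sets would each own their first difference.

    Superincreasing radii turn lexicographic comparison into comparison of
    totals.  At the first difference [i] the lex-max set owns ring [i], and
    everything another set may hold beyond [i] is worth less than [v (r i)]:
    the radii beyond [i] sum to less than [r i], and superadditivity and
    monotonicity carry this over to [v] ([superadditive_sum_lt]).

    The contact area qualifies as such a [v]: it is a multiple of the function
    that is [x ^+ 2] up to [w] and continues along its tangent
    [2 * w * x - w ^+ 2], which is convex and vanishes at [0]. *)

(** * The greedy scan of a family closed under initial segments *)

Definition initial {n : nat} (k : nat) (S : {set 'I_n}) : {set 'I_n} :=
  [set i in S | (i < k)%N]%SET.

Definition greedy_step {n : nat} (F : {set 'I_n} -> Prop) (A : {set 'I_n})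
    (i : 'I_n) : {set 'I_n} :=
  if `[< F (i |: A)%SET >] then (i |: A)%SET else A.

Definition lex_beats {n : nat} (A S : {set 'I_n}) (i : 'I_n) : Prop :=
  [/\ i \in A, i \notin S & forall j : 'I_n, (j < i)%N -> (j \in S) = (j \in A)].

Lemma initial_oversize (n : nat) (S : {set 'I_n}) : initial n S = S.
Proof. by apply/setP => i; rewrite inE ltn_ord andbT. Qed.

Lemma initialS (n : nat) (S : {set 'I_n}) (k : 'I_n) :
  initial k.+1 S = if k \in S then (k |: initial k S)%SET else initial k S.
Proof.
apply/setP => i; have [-> | neq_ik] := eqVneq i k.
  by case: ifP => kS; rewrite !inE kS ?eqxx ?ltnSn.
have eq_lt : (i < k.+1)%N = (i < k)%N.
  by rewrite ltnS leq_eqVlt val_eqE (negPf neq_ik).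
by case: ifP => kS; rewrite !inE eq_lt ?(negPf neq_ik).
Qed.

(** The invariant of the scan: after [k] steps a member of [F] has either made
    the same choices as the greedy or already lost to it.  The bound [i < k]
    keeps a loss final, since later steps only touch indices from [k] on. *)
Lemma greedy_initial (n : nat) (F : {set 'I_n} -> Prop)
    (F0 : F finset.set0)
    (F_initial : forall (k : nat) (S : {set 'I_n}), F S -> F (initial k S))
    (k : nat) :
  (k <= n)%N ->
  let A := foldl (greedy_step F) finset.set0 (take k (enum 'I_n)) in
  F A /\
  forall S, F S -> initial k S = A \/ exists2 i : 'I_n, (i < k)%N & lex_beats A S i.
Proof.
elim: k => [_ | k IHk lt_kn] /=.
  rewrite take0 /=; split=> // S _; left.
  by apply/setP => i; rewrite !inE ltn0 andbF.
have [] := IHk (ltnW lt_kn).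
rewrite (take_nth (Ordinal lt_kn)) ?size_enum_ord // foldl_rcons.
rewrite (_ : nth _ _ k = Ordinal lt_kn); last first.
  by apply: val_inj; rewrite /= nth_enum_ord.
set A := foldl _ _ _; set x := Ordinal lt_kn => FA IH.
have step_lt (i : 'I_n) : (i < k)%N -> (i \in greedy_step F A x) = (i \in A).
  move=> lt_ik; rewrite /greedy_step; case: ifP => // _.
  by rewrite !inE -val_eqE /= ltn_eqF.
split; first by rewrite /greedy_step; case: ifP => // /asboolP.
move=> S FS; have [eqSA | [i lt_ik [iA iS eq_lt]]] := IH S FS; last first.
  right; exists i; first exact: ltnW.
  split=> // [|j lt_ji]; first by rewrite step_lt.
  by rewrite step_lt ?eq_lt // (ltn_trans lt_ji).
have eqS : initial k.+1 S = if x \in S then (x |: A)%SET else A.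
  by rewrite -eqSA -[k.+1]/((x : nat).+1) initialS.
case: (boolP (x \in S)) eqS => xS eqS.
  left; rewrite eqS /greedy_step ifT //.
  by apply/asboolP; rewrite -eqS; apply: F_initial.
rewrite eqS /greedy_step; case: ifP => [Fx | _]; last by left.
right; exists x; first exact: ltnSn.
split=> // [|j lt_jx]; first by rewrite setU11.
by rewrite -eqSA !inE -val_eqE /= ltn_eqF //= lt_jx andbT.
Qed.

Lemma greedy_lex_beats (n : nat) (F : {set 'I_n} -> Prop)
    (F0 : F finset.set0)
    (F_initial : forall (k : nat) (S : {set 'I_n}), F S -> F (initial k S)) :
  let A := foldl (greedy_step F) finset.set0 (enum 'I_n) in
  F A /\ forall S, F S -> S <> A -> exists i, lex_beats A S i.
Proof.
have := greedy_initial F0 F_initial (leqnn n).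
rewrite take_oversize ?size_enum_ord //= => -[FA beats]; split=> // S FS neqSA.
have [|[i _ beat]] := beats S FS; last by exists i.
by rewrite initial_oversize.
Qed.

Lemma lex_beats_asym (n : nat) (A B : {set 'I_n}) (i j : 'I_n) :
  lex_beats A B i -> lex_beats B A j -> False.
Proof.
move=> [iA iB eqA] [jB jA eqB]; case: (ltngtP i j) => [lt_ij|lt_ji|/val_inj eq_ij].
- by move: iB; rewrite -eqB // iA.
- by move: jA; rewrite -eqA // jB.
- by move: iB; rewrite eq_ij jB.
Qed.

(** * Placements of rings *)

Section Placements.
Context {R : realType} {d n : nat} (K : set 'rV[R]_d) (w : R) (r : 'I_n -> R).

Lemma packable_sub (Q : set 'rV[R]_d) (C D : {set 'I_n}) :
  C \subset D -> packable r Q D -> packable r Q C.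
Proof.
move=> /fintype.subsetP sCD [c [inQ disj]]; exists c; split=> [i /sCD|i j /sCD iD /sCD jD].
  exact: inQ.
exact: disj.
Qed.

Lemma feasible_set0 : feasible K w r finset.set0.
Proof.
exists (fun=> None); split=> [i j||j]; rewrite ?inE //.
by exists (fun=> 0); split=> [i|i j]; rewrite !inE.
Qed.

(** A parent has a smaller index than its children, so the parent assignment of
    the whole set still serves an initial segment. *)
Lemma feasible_initial (w_gt0 : 0 < w)
    (r_decr : forall i j : 'I_n, (i < j)%N -> r j < r i)
    (k : nat) (S : {set 'I_n}) :
  feasible K w r S -> feasible K w r (initial k S).
Proof.
have sub (p : pred 'I_n) :
    [set i in initial k S | p i]%SET \subset [set i in S | p i]%SET.
  by apply/fintype.subsetP => i; rewrite !inE => /andP[/andP[-> _] ->].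
move=> [p [parentP panP holeP]]; exists p; split=> [i j|| j].
- rewrite inE => /andP[iS lt_ik] /(parentP _ _ iS)[jS neq_ji le_r].
  split=> //; rewrite inE jS /= (leq_trans _ lt_ik) // ltnS leqNgt.
  apply/negP => /r_decr; apply/negP; rewrite -leNgt (le_trans le_r) //.
  by rewrite gerBl ltW.
- exact: packable_sub (sub _) panP.
- by rewrite inE => /andP[jS _]; apply: packable_sub (sub _) (holeP j jS).
Qed.

Lemma selection_greedy_lex_max (w_gt0 : 0 < w)
    (r_decr : forall i j : 'I_n, (i < j)%N -> r j < r i) :
  lex_max K w r (selection_greedy K w r).
Proof. exact: greedy_lex_beats feasible_set0 (feasible_initial w_gt0 r_decr). Qed.

Lemma lex_max_inj (L M : {set 'I_n}) :
  lex_max K w r L -> lex_max K w r M -> L = M.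
Proof.
move=> [FL maxL] [FM maxM]; apply: contrapT => neqLM.
have [i beatL] := maxL M FM (nesym neqLM).
have [j beatM] := maxM L FL neqLM.
exact: lex_beats_asym beatL beatM.
Qed.

End Placements.

(** * Superadditive values of superincreasing radii *)

(** Nothing is known about [v 0], so the inequality
    [\sum_i v (r i) <= v (\sum_i r i)] may fail for an empty sum.  Comparing
    with a strict upper bound [y] covers that case too, because then [0 < y]. *)
Lemma superadditive_sum_lt (R : realType) (v : R -> R)
    (v_gt0 : forall x : R, 0 < x -> 0 < v x)
    (v_incr : forall x y : R, 0 < x -> x < y -> v x < v y)
    (v_superadd : forall x y : R, 0 < x -> 0 < y -> v x + v y <= v (x + y))
    (I : finType) (P : pred I) (r : I -> R) (r_gt0 : forall i, 0 < r i) (y : R) :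
  \sum_(i | P i) r i < y -> \sum_(i | P i) v (r i) < v y.
Proof.
have [[-> ->] | [sum_gt0 le_sum]] :
    (\sum_(i | P i) v (r i) = 0 /\ \sum_(i | P i) r i = 0) \/
    (0 < \sum_(i | P i) r i /\ \sum_(i | P i) v (r i) <= v (\sum_(i | P i) r i)).
- elim/big_rec2: _ => [|i t s _ [[-> ->]|[t_gt0 le_st]]]; first by left.
    by right; rewrite !addr0.
  right; split; first exact: addr_gt0.
  by apply: le_trans (v_superadd _ _ _ _) => //; rewrite lerD2l.
- exact: v_gt0.
- by move=> lt_y; apply: le_lt_trans le_sum (v_incr _ _ sum_gt0 lt_y).
Qed.

Lemma lex_beats_total (R : realType) (n : nat) (r : 'I_n -> R) (v : R -> R)
    (r_gt0 : forall i : 'I_n, 0 < r i)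
    (r_superincr : forall i : 'I_n, \sum_(j < n | (i < j)%N) r j < r i)
    (v_gt0 : forall x : R, 0 < x -> 0 < v x)
    (v_incr : forall x y : R, 0 < x -> x < y -> v x < v y)
    (v_superadd : forall x y : R, 0 < x -> 0 < y -> v x + v y <= v (x + y))
    (L S : {set 'I_n}) (i : 'I_n) :
  lex_beats L S i -> Defs.total v r S < Defs.total v r L.
Proof.
move=> [iL iS eq_lt]; rewrite /Defs.total.
rewrite (bigID (fun j : 'I_n => (j < i)%N)) /=.
rewrite [ltRHS](bigID (fun j : 'I_n => (j < i)%N)) /=.
rewrite (eq_bigl (fun j : 'I_n => (j \in L) && (j < i)%N)); last first.
  by move=> j /=; case: ltnP => [/eq_lt -> | _]; rewrite ?andbF.
rewrite ltrD2l; apply: (@lt_le_trans _ _ (v (r i))).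
  apply: le_lt_trans (superadditive_sum_lt v_gt0 v_incr v_superadd r_gt0
    (r_superincr i)).
  rewrite big_mkcond [leRHS]big_mkcond; apply: ler_sum => j _.
  rewrite -leqNgt leq_eqVlt val_eqE.
  case: eqP => [<- | _] /=; first by rewrite (negPf iS) ltnn.
  by case: (i < j)%N; case: (j \in S) => //=; apply/ltW/v_gt0.
rewrite (bigD1 i) /= ?iL ?ltnn // lerDl.
by apply: sumr_ge0 => j _; apply/ltW/v_gt0.
Qed.

Lemma lex_max_maximizes_total (R : realType) (d n : nat) (K : set 'rV[R]_d)
    (w : R) (r : 'I_n -> R) (v : R -> R)
    (r_gt0 : forall i : 'I_n, 0 < r i)
    (r_superincr : forall i : 'I_n, \sum_(j < n | (i < j)%N) r j < r i)
    (v_gt0 : forall x : R, 0 < x -> 0 < v x)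
    (v_incr : forall x y : R, 0 < x -> x < y -> v x < v y)
    (v_superadd : forall x y : R, 0 < x -> 0 < y -> v x + v y <= v (x + y))
    (L : {set 'I_n}) :
  lex_max K w r L -> maximizes_total K w r v L.
Proof.
move=> [FL maxL]; split=> // S FS.
have [-> // | /eqP neqSL] := eqVneq S L.
have [i beat] := maxL S FS neqSL.
exact/ltW/(lex_beats_total r_gt0 r_superincr v_gt0 v_incr v_superadd beat).
Qed.

(** * The contact area *)

Section ContactArea.
Context {R : realType} (w : R) (w_gt0 : 0 < w).

Lemma contact_area_gt0 (x : R) : 0 < x -> 0 < contact_area w x.
Proof.
move=> x_gt0; rewrite /contact_area /hole_radius mulr_gt0 ?pi_gt0 //.
case: (leP 0 (x - w)) => hx; last by rewrite expr0n subr0 exprn_gt0.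
have ? := mulr_gt0 w_gt0 x_gt0.
have ? := mulr_ge0 (ltW w_gt0) hx.
nra.
Qed.

Lemma contact_area_incr (x y : R) :
  0 < x -> x < y -> contact_area w x < contact_area w y.
Proof.
move=> x_gt0 lt_xy; rewrite /contact_area /hole_radius ltr_pM2l ?pi_gt0 //.
have ? : 0 < w * (y - x) by rewrite mulr_gt0 ?subr_gt0.
by case: (leP 0 (x - w)) => hx; case: (leP 0 (y - w)) => hy; nra.
Qed.

(** The delicate case is [x, y < w <= x + y]: it amounts to
    [(w - x) ^+ 2 + (w - y) ^+ 2 <= w ^+ 2], which holds because [w - x] and
    [w - y] are nonnegative with sum at most [w]. *)
Lemma contact_area_superadd (x y : R) : 0 < x -> 0 < y ->
  contact_area w x + contact_area w y <= contact_area w (x + y).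
Proof.
move=> x_gt0 y_gt0; rewrite /contact_area /hole_radius -mulrDr.
rewrite ler_pM2l ?pi_gt0 //.
case: (leP 0 (x - w)) => hx; case: (leP 0 (y - w)) => hy;
  case: (leP 0 (x + y - w)) => hxy; nra.
Qed.

End ContactArea.

Theorem theorem6 (R : realType) (d : nat) (d_gt0 : (0 < d)%N)
    (K : set 'rV[R]_d) (K_compact : compact K)
    (w : R) (w_gt0 : 0 < w)
    (n : nat) (r : 'I_n -> R)
    (r_gt0 : forall i : 'I_n, 0 < r i)
    (r_decr : forall i j : 'I_n, (i < j)%N -> r j < r i)
    (r_superincr : forall i : 'I_n, \sum_(j < n | (i < j)%N) r j < r i) :
  [/\ unique (lex_max K w r) (selection_greedy K w r),
      forall v : R -> R,
        (forall x : R, 0 < x -> 0 < v x) ->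
        (forall x y : R, 0 < x -> x < y -> v x < v y) ->
        (forall x y : R, 0 < x -> 0 < y -> v x + v y <= v (x + y)) ->
        maximizes_total K w r v (selection_greedy K w r)
    & maximizes_total K w r (contact_area w) (selection_greedy K w r)].
Proof.
have maxG := selection_greedy_lex_max K w_gt0 r_decr.
split.
- by split=> // L; apply: lex_max_inj.
- by move=> v *; apply: lex_max_maximizes_total maxG.
- apply: lex_max_maximizes_total maxG => //.
  + exact: contact_area_gt0.
  + exact: contact_area_incr.
  + exact: contact_area_superadd.
Qed.
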